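(* Let $R$ be a ring and let $M$ be an abelian endoregular right $R$-module. Then every direct summand of $M$ is an abelian endoregular module.
   Context: Rings are associative with identity and modules are unitary right modules. A ring $S$ is von Neumann regular if for every $s\in S$ there is $x\in S$ with $sxs=s$; it is abelian if every idempotent of $S$ is central. A module $M$ is abelian endoregular if $\operatorname{End}_R(M)$ is an abelian von Neumann regular ring. *)

(* Defs.v *)
From HB Require Import structures.
From mathcomp Require Import all_boot all_algebra.
From mathcomp Require Import boolp.

Set Implicit Arguments.
Unset Strict Implicit.
Unset Printing Implicit Defensive.

Import GRing.Theory.
Local Open Scope ring_scope.

(* [pzRingType] (rather than [nzRingType]) is used throughout, since the zero
   ring is allowed and the endomorphism ring of the zero module is the zero
   ring.  A right R-module is an [lmodType] over the converse ring [R^c]; the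
   multiplication of [endo M] is composition of maps written on the left. *)

Definition von_neumann_regular (S : pzRingType) : Prop :=
  forall s : S, exists x : S, s * x * s = s.

Definition abelian_ring (S : pzRingType) : Prop :=
  forall e : S, e * e = e -> forall s : S, e * s = s * e.

Definition endo (R : pzRingType) (M : lmodType R) : Type := {linear M -> M}.

Section EndoRing.
Variables (R : pzRingType) (M : lmodType R).

Definition fun_of_endo (f : endo M) : M -> M :=
  GRing.Linear.sort (f : {linear M -> M}).

Lemma endoP (f g : endo M) : fun_of_endo f =1 fun_of_endo g -> f = g.
Proof.
case: f g => [f Cf] [g Cg] /= /funext; rewrite /fun_of_endo /= => efg.
move: Cf Cg; rewrite efg => -[[a1] [b1]] [[a2] [b2]].
by rewrite (Prop_irrelevance a1 a2) (Prop_irrelevance b1 b2).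
Qed.

HB.instance Definition _ := gen_eqMixin (endo M).
HB.instance Definition _ := gen_choiceMixin (endo M).

Definition endo_zero : endo M := (\0 : M -> M) : {linear M -> M}.
Definition endo_one : endo M := (idfun : M -> M) : {linear M -> M}.
Definition endo_opp (f : endo M) : endo M :=
  (\- (f : {linear M -> M})) : {linear M -> M}.
Definition endo_add (f g : endo M) : endo M :=
  ((f : {linear M -> M}) \+ (g : {linear M -> M})) : {linear M -> M}.
Definition endo_mul (f g : endo M) : endo M :=
  ((f : {linear M -> M}) \o (g : {linear M -> M})) : {linear M -> M}.

Fact endo_addA : associative endo_add.
Proof. by move=> f g h; apply: endoP => m; apply: addrA. Qed.
Fact endo_addC : commutative endo_add.
Proof. by move=> f g; apply: endoP => m; apply: addrC. Qed.
Fact endo_add0 : left_id endo_zero endo_add.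
Proof. by move=> f; apply: endoP => m; apply: add0r. Qed.
Fact endo_addN : left_inverse endo_zero endo_opp endo_add.
Proof. by move=> f; apply: endoP => m; apply: addNr. Qed.

HB.instance Definition _ :=
  GRing.isZmodule.Build (endo M) endo_addA endo_addC endo_add0 endo_addN.

Fact endo_mulA : associative endo_mul.
Proof. by move=> f g h; apply: endoP. Qed.
Fact endo_mul1 : left_id endo_one endo_mul.
Proof. by move=> f; apply: endoP. Qed.
Fact endo_mulr1 : right_id endo_one endo_mul.
Proof. by move=> f; apply: endoP. Qed.
Fact endo_mulDl : left_distributive endo_mul +%R.
Proof. by move=> f g h; apply: endoP. Qed.
Fact endo_mulDr : right_distributive endo_mul +%R.
Proof.
by move=> f g h; apply: endoP => m; apply: (raddfD (f : {linear M -> M})).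
Qed.

HB.instance Definition _ :=
  GRing.Zmodule_isPzRing.Build (endo M)
    endo_mulA endo_mul1 endo_mulr1 endo_mulDl endo_mulDr.

Definition abelian_endoregular : Prop :=
  abelian_ring (endo M) /\ von_neumann_regular (endo M).

(* Internal direct sum decomposition M = P (+) Q into submodules. *)
Definition direct_summand (P : pred M) : Prop :=
  submod_closed P /\
  exists Q : pred M,
    [/\ submod_closed Q,
        forall m : M, exists x y : M, [/\ P x, Q y & m = x + y]
      & forall m : M, P m -> Q m -> m = 0].

End EndoRing.
Arguments abelian_endoregular {R} M.

(* Main.v *)
Require Import Defs.
From HB Require Import structures.
From mathcomp Require Import all_boot all_algebra.
From mathcomp Require Import boolp.

Import GRing.Theory.
Local Open Scope ring_scope.

(** A direct summand N of M is a retract: the inclusion i : N -> M has a linear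
    left inverse p : M -> N.  Then f |-> i f p embeds End(N) in End(M) as a
    (non-unital) subring, with retraction g |-> p g i; an idempotent of End(N)
    stays idempotent in End(M), and a quasi-inverse x of i f p restricts to the
    quasi-inverse p x i of f. *)

Section Retract.
Variables (R : pzRingType) (M N : lmodType R).
Variables (i : {linear N -> M}) (p : {linear M -> N}).
Hypothesis iK : cancel i p.

Definition endo_extend (f : endo N) : endo M :=
  (i \o ((f : {linear N -> N}) \o p)) : {linear M -> M}.

Definition endo_compress (g : endo M) : endo N :=
  (p \o ((g : {linear M -> M}) \o i)) : {linear N -> N}.

Lemma endo_extendK : cancel endo_extend endo_compress.
Proof. by move=> f; apply: endoP => n; rewrite /fun_of_endo /= !iK. Qed.

Lemma endo_extendM (f g : endo N) :
  endo_extend (f * g) = endo_extend f * endo_extend g.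
Proof. by apply: endoP => m; rewrite /fun_of_endo /= iK. Qed.

Lemma endo_compress_extendM (f g : endo N) (x : endo M) :
  endo_compress (endo_extend f * x * endo_extend g) = f * endo_compress x * g.
Proof. by apply: endoP => n; rewrite /fun_of_endo /= !iK. Qed.

Lemma abelian_endoregular_retract :
  abelian_endoregular M -> abelian_endoregular N.
Proof.
move=> [abM regM]; split=> [e ee s | f].
  (* Commutation is checked in End(M), as [endo_extend] is injective and multiplicative. *)
  apply: (can_inj endo_extendK); rewrite !endo_extendM.
  by apply: abM; rewrite -endo_extendM ee.
have [x xP] := regM (endo_extend f); exists (endo_compress x).
by rewrite -endo_compress_extendM xP endo_extendK.
Qed.

End Retract.

(** The retraction is the projection along the complement [Q]: it sends [m] to the unique [n] with
    [m - val n] in [Q]. *)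
Lemma direct_summand_retraction (R : pzRingType) (M : lmodType R) (P : pred M)
    (N : subLmodType P) :
  direct_summand P -> exists p : {linear M -> N}, cancel (val : N -> M) p.
Proof.
move=> [_ [Q [[Q0 Qlin] PQsum PQ0]]].
have exproj m : exists n : N, m - val n \in Q.
  have [x [y [Px Qy ->]]] := PQsum m.
  by exists (Sub x Px); rewrite SubK addrC addKr.
pose p m := sval (cid (exproj m)).
have pP m : m - val (p m) \in Q by rewrite /p; case: cid.
(* Two candidates differ by an element of both [P] and [Q], hence agree. Linearity and the
   left-inverse law both follow from this uniqueness. *)
have p_uniq m n : m - val n \in Q -> p m = n.
  move=> Qn; apply/eqP; rewrite -subr_eq0; apply/eqP/val_inj; rewrite raddf0.
  apply: PQ0; first exact: valP.
  have := Qlin (-1) _ _ (pP m) Qn.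
  by rewrite scaleN1r opprB addrA subrK raddfB.
have p_lin : linear p.
  move=> a u v; apply: p_uniq.
  have := Qlin a _ _ (pP u) (pP v).
  by rewrite linearP scalerBr opprD addrACA.
pose pM := GRing.isLinear.Build _ _ _ _ p p_lin.
pose pL : {linear M -> N} := HB.pack p pM.
by exists pL => n; apply: p_uniq; rewrite subrr.
Qed.

(* [N : subLmodType P] is the submodule of M with underlying set P, as a
   module in its own right. *)
Theorem corollary2p7 (R : pzRingType) (M : lmodType R^c)
    (P : pred M) (N : subLmodType P) :
  abelian_endoregular M -> direct_summand P -> abelian_endoregular N.
Proof.
move=> aeM /(@direct_summand_retraction _ _ _ N)[p valK].
exact: (@abelian_endoregular_retract _ M N val p valK aeM).
Qed.
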